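(* Let $\mathcal{X}=(\mathcal{M},X,\bot)$ be a non trivial concurrent system. 1. If $\Sigma_\alpha\neq\emptyset$ for all $\alpha\in X$, then $\mathcal{X}$ is deterministic if and only if the dominant valuation of $\mathcal{X}$ is probabilistic. 2. If $\mathcal{X}$ is deterministic, then every set $\partial\mathcal{M}_\alpha$, $\alpha\in X$, is at most countable, and the characteristic root of $\mathcal{X}$ is $r=1$ or $r=\infty$.
   Context: Trace monoids. Let $\Sigma$ be a finite alphabet and $I\subseteq\Sigma\times\Sigma$ a symmetric irreflexive relation; $D=(\Sigma\times\Sigma)\setminus I$. The trace monoid is $\mathcal{M}=\langle\Sigma\mid ab=ba\text{ for }(a,b)\in I\rangle$ with unit $\varepsilon$; $|x|$ is the length of $x$. The order $x\le y$ means $y=x\cdot z$ for some $z$. A clique is a trace $a_1\cdots a_k$ of distinct letters pairwise in $I$, identified with a subset of $\Sigma$; $\mathscr{C}$ is the set of cliques, $\mathfrak{C}=\mathscr{C}\setminus\{\varepsilon\}$. Cliques $x\to y$ (normal pair) if every $b\in y$ has some $a\in x$ with $(a,b)\in D$. A generalised trace is a sequence $(c_i)_{i\ge1}$ of cliques with $c_i\to c_{i+1}$; finite traces are identified (via Cartier–Foata normal form padded with $\varepsilon$) with those having some $c_i=\varepsilon$; those with all $c_i\ne\varepsilon$ are infinite traces, forming $\partial\mathcal{M}$. Generalised traces are ordered by $(c_i)\le(d_i)$ iff $c_i\subseteq d_i$ for all $i$. Concurrent systems. A concurrent system is $(\mathcal{M},X,\bot)$ with $X$ a finite set, $\bot\notin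 X$, and a right action of $\mathcal{M}$ on $X\cup\{\bot\}$ with $\bot\cdot x=\bot$. It is non trivial if $\alpha\cdot a\ne\bot$ for some $\alpha\in X$, $a\in\Sigma$. Put $\mathcal{M}_\alpha=\{x:\alpha\cdot x\ne\bot\}$, $\mathcal{M}_{\alpha,\beta}=\{x:\alpha\cdot x=\beta\}$, $\Sigma_\alpha=\Sigma\cap\mathcal{M}_\alpha$, $\mathscr{C}_\alpha=\mathscr{C}\cap\mathcal{M}_\alpha$, $\mathfrak{C}_\alpha=\mathfrak{C}\cap\mathcal{M}_\alpha$, $\mathscr{C}_{\alpha,\beta}=\mathscr{C}\cap\mathcal{M}_{\alpha,\beta}$. $\partial\mathcal{M}_\alpha$ is the set of $\xi\in\partial\mathcal{M}$ such that every finite $x\le\xi$ lies in $\mathcal{M}_\alpha$. The system is deterministic if $(\mathcal{M}_\alpha,\le)$ is a lattice for every $\alpha$. Characteristic root: with $\mu_{\alpha,\beta}(z)=\sum_{c\in\mathscr{C}_{\alpha,\beta}}(-1)^{|c|}z^{|c|}$ and $\theta(z)=\det(\mu_{\alpha,\beta}(z))_{\alpha,\beta\in X}$, one of the roots of smallest modulus of $\theta$ is real in $(0,1]$, or one takes $\infty$ if $\theta$ is a nonzero constant; this is the characteristic root $r$. It equals the minimum of the radii of convergence of $\sum_{x\in\mathcal{M}_{\alpha,\beta}}z^{|x|}$. Valuations: a valuation is $f=(f_\alpha)_{\alpha\in X}$, $f_\alpha:\mathcal{M}\to\mathbb{R}_{\ge0}$, with $f_\alpha(x)=0$ if $\alpha\cdot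 x=\bot$, $f_\alpha(xy)=f_\alpha(x)f_{\alpha\cdot x}(y)$ for $x\in\mathcal{M}_\alpha,y\in\mathcal{M}_{\alpha\cdot x}$, and $f_\alpha(\varepsilon)=1$. Möbius transform: $h_\alpha(c)=\sum_{c'\in\mathscr{C},c\le c'}(-1)^{|c'|-|c|}f_\alpha(c')$. $f$ is probabilistic if for all $\alpha$, $h_\alpha(\varepsilon)=0$ and $h_\alpha(c)\ge0$ for $c\in\mathfrak{C}_\alpha$. The dominant valuation is $f_\alpha=\mathbf{1}_{\mathcal{M}_\alpha}$. *)

(* Defs.v *)
From HB Require Import structures.
From Stdlib Require Import Relation_Operators.
From mathcomp Require Import all_boot all_order all_algebra.
From mathcomp Require Import boolp classical_sets cardinality.
From mathcomp Require Import reals constructive_ereal numfun.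
From mathcomp Require Import complex.

Set Implicit Arguments.
Unset Strict Implicit.
Unset Printing Implicit Defensive.

Import Order.TTheory GRing.Theory Num.Theory.

Section TraceMonoid.
Variables (Sigma : finType) (I : rel Sigma).

Variant swap : seq Sigma -> seq Sigma -> Prop :=
  Swap u v a b of I a b : swap (u ++ [:: a; b] ++ v) (u ++ [:: b; a] ++ v).

Definition trace_eq : seq Sigma -> seq Sigma -> Prop :=
  clos_refl_sym_trans (seq Sigma) swap.

Lemma trace_eq_cat u u' v v' :
  trace_eq u u' -> trace_eq v v' -> trace_eq (u ++ v) (u' ++ v').
Proof.
move=> uu' vv'; apply: (@rst_trans _ _ _ (u' ++ v)).
  elim: uu' => {u u'}.
  - by move=> _ _ [u w a b Iab]; rewrite -!catA; apply: rst_step; split.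
  - by move=> u; apply: rst_refl.
  - by move=> u w _; apply: rst_sym.
  - by move=> u w t _ uw _; apply: rst_trans uw.
elim: vv' => {v v'}.
- move=> _ _ [v w a b Iab]; rewrite 2![u' ++ v ++ _]catA.
  by apply: rst_step; split.
- by move=> v; apply: rst_refl.
- by move=> v w _; apply: rst_sym.
- by move=> v w t _ vw _; apply: rst_trans vw.
Qed.

Lemma trace_eq_perm u v : trace_eq u v -> perm_eq u v.
Proof.
elim=> {u v}.
- move=> _ _ [u v a b _]; rewrite perm_cat2l perm_cat2r.
  by rewrite (perm_catC [:: a] [:: b]).
- by move=> u; apply: perm_refl.
- by move=> u v _; rewrite perm_sym.
- by move=> u v w _ uv _; apply: perm_trans uv.
Qed.

Definition trace_eqb : rel (seq Sigma) := fun u v => `[< trace_eq u v >].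

Lemma trace_eqb_refl : reflexive trace_eqb.
Proof. by move=> u; apply/asboolP; apply: rst_refl. Qed.

Lemma trace_eqb_sym : symmetric trace_eqb.
Proof. by move=> u v; apply/asboolP/asboolP; apply: rst_sym. Qed.

Lemma trace_eqb_trans : transitive trace_eqb.
Proof.
by move=> v u w /asboolP uv /asboolP vw; apply/asboolP; apply: rst_trans uv vw.
Qed.

Canonical trace_equiv : equiv_rel (seq Sigma) :=
  EquivRel trace_eqb trace_eqb_refl trace_eqb_sym trace_eqb_trans.

Definition trace : Type := {eq_quot trace_equiv}%qT.
HB.instance Definition _ := EqQuotient.on trace.
HB.instance Definition _ := Choice.on trace.

Definition word_trace (w : seq Sigma) : trace := (\pi_trace w)%qT.

Lemma word_traceK (x : trace) : word_trace (repr x) = x.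
Proof. exact: reprK. Qed.

Lemma word_trace_eqP u v : word_trace u = word_trace v <-> trace_eq u v.
Proof.
split=> [/eqP|uv]; first by rewrite eqmodE => /asboolP.
by apply/eqP; rewrite eqmodE; apply/asboolP.
Qed.

Definition trace_mul (x y : trace) : trace := word_trace (repr x ++ repr y).

Lemma word_trace_cat u v :
  word_trace (u ++ v) = trace_mul (word_trace u) (word_trace v).
Proof.
by apply/word_trace_eqP; apply: trace_eq_cat; apply/word_trace_eqP;
  rewrite word_traceK.
Qed.

Lemma trace_mulA : associative trace_mul.
Proof.
move=> x y z; rewrite -(word_traceK x) -(word_traceK y) -(word_traceK z).
by rewrite -!word_trace_cat catA.
Qed.

Lemma trace_mul1 : left_id (word_trace [::]) trace_mul.
Proof. by move=> x; rewrite -(word_traceK x) -word_trace_cat. Qed.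

Lemma trace_mulr1 : right_id (word_trace [::]) trace_mul.
Proof. by move=> x; rewrite -(word_traceK x) -word_trace_cat cats0. Qed.

HB.instance Definition _ :=
  isMonoid.Build trace trace_mulA trace_mul1 trace_mulr1.

Definition letter (a : Sigma) : trace := word_trace [:: a].

Definition trace_length (x : trace) : nat := size (repr x).

Lemma trace_length_word w : trace_length (word_trace w) = size w.
Proof.
by apply: perm_size; apply: trace_eq_perm; apply/word_trace_eqP;
  rewrite word_traceK.
Qed.

Lemma trace_lengthM (x y : trace) :
  trace_length (x * y)%g = trace_length x + trace_length y.
Proof. by rewrite [LHS]trace_length_word size_cat. Qed.

Lemma trace_length0 (x : trace) : trace_length x = 0 -> x = 1%g.
Proof. by move/size0nil => x0; rewrite -(word_traceK x) x0. Qed.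

Definition trace_le : rel trace := fun x y => `[< exists z, y = (x * z)%g >].

Lemma trace_le_refl : reflexive trace_le.
Proof. by move=> x; apply/asboolP; exists 1%g; rewrite mulg1. Qed.

Lemma trace_le_anti : antisymmetric trace_le.
Proof.
move=> x y /andP[/asboolP[z ->] /asboolP[t xE]].
have /eqP := congr1 trace_length xE.
rewrite !trace_lengthM -addnA -[X in X == _]addn0 eqn_add2l eq_sym addn_eq0.
by move=> /andP[/eqP/trace_length0 -> _]; rewrite mulg1.
Qed.

Lemma trace_le_trans : transitive trace_le.
Proof.
move=> y x z /asboolP[u ->] /asboolP[v ->]; apply/asboolP.
by exists (u * v)%g; rewrite mulgA.
Qed.

Fact trace_display : Order.disp_t. Proof. by []. Qed.

HB.instance Definition _ := Order.Le_isPOrder.Build trace_display trace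
  trace_le_refl trace_le_anti trace_le_trans.

Lemma trace_leP (x y : trace) :
  reflect (exists z, y = (x * z)%g) (x <= y)%O.
Proof. exact: asboolP. Qed.

(* Cliques are carried by subsets of the alphabet; [clique_trace c] is the
   corresponding element of the trace monoid. *)
Definition is_clique (c : {set Sigma}) : bool :=
  [forall a in c, forall b in c, (a != b) ==> I a b].

Definition clique_trace (c : {set Sigma}) : trace := word_trace (enum c).

Lemma trace_length_clique (c : {set Sigma}) :
  trace_length (clique_trace c) = #|c|.
Proof. by rewrite trace_length_word -cardE. Qed.

Definition normal_pair (c d : {set Sigma}) : bool :=
  [forall b in d, exists a in c, ~~ I a b].

(* Sequences are indexed from 0. *)
Definition generalised_trace (xi : nat -> {set Sigma}) : Prop :=
  (forall i, is_clique (xi i)) /\ (forall i, normal_pair (xi i) (xi i.+1)).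

Definition infinite_trace (xi : nat -> {set Sigma}) : Prop :=
  generalised_trace xi /\ forall i, xi i != finset.set0.

(* [d] is the Cartier-Foata normal form of [x], padded with the empty clique. *)
Definition cartier_foata (x : trace) (d : nat -> {set Sigma}) : Prop :=
  generalised_trace d /\
  exists n, (forall i, n <= i -> d i = finset.set0) /\
            x = (\big[*%g/1]_(i < n) clique_trace (d i))%g.

Definition gtrace_le (c d : nat -> {set Sigma}) : Prop :=
  forall i, c i \subset d i.

Definition finite_le (x : trace) (xi : nat -> {set Sigma}) : Prop :=
  exists2 d, cartier_foata x d & gtrace_le d xi.

End TraceMonoid.

(* The suborder induced on [A] is a lattice: joins and meets range over [A]. *)
Definition lattice_on (disp : Order.disp_t) (T : porderType disp)
    (A : set T) : Prop :=
  forall x y, A x -> A y ->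
    (exists2 j, A j &
       forall z, A z -> (j <= z)%O = (x <= z)%O && (y <= z)%O) /\
    (exists2 m, A m &
       forall z, A z -> (z <= m)%O = (z <= x)%O && (z <= y)%O).

(* [None] plays the role of the sink state. *)
Record concurrent_system (Sigma : finType) (I : rel Sigma) (X : finType) := {
  act : option X -> trace I -> option X;
  act1 : forall s, act s 1%g = s;
  actM : forall s x y, act s (x * y)%g = act (act s x) y;
  act_sink : forall x, act None x = None }.

Section ConcurrentSystem.
Variables (Sigma : finType) (I : rel Sigma) (X : finType).
Variable S : concurrent_system I X.

Definition nontrivial : Prop :=
  exists (alpha : X) (a : Sigma), act S (Some alpha) (letter I a) <> None.

Definition executions (alpha : X) : set (trace I) :=
  fun x => act S (Some alpha) x <> None.

Definition enabled (alpha : X) : {set Sigma} :=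
  finset (fun a : Sigma => act S (Some alpha) (letter I a) != None).

Definition infinite_executions (alpha : X) : set (nat -> {set Sigma}) :=
  fun xi => infinite_trace I xi /\
    forall x, finite_le x xi -> executions alpha x.

Definition deterministic : Prop := forall alpha, lattice_on (executions alpha).

Local Open Scope ring_scope.

Definition mobius_matrix : 'M[{poly int}]_#|X| :=
  \matrix_(i, j)
    \sum_(c : {set Sigma} | is_clique I c &&
        (act S (Some (enum_val i)) (clique_trace I c) == Some (enum_val j)))
      (-1) ^+ #|c| *: 'X^#|c|.

Definition theta : {poly int} := \det mobius_matrix.

Section Valuations.
Variable R : realType.

Record valuation := {
  val_fun : X -> trace I -> R;
  val_ge0 : forall alpha x, 0 <= val_fun alpha x;
  val_sink : forall alpha x,
    act S (Some alpha) x = None -> val_fun alpha x = 0;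
  valM : forall alpha beta x y,
    act S (Some alpha) x = Some beta -> act S (Some beta) y <> None ->
    val_fun alpha (x * y)%g = val_fun alpha x * val_fun beta y;
  val1 : forall alpha, val_fun alpha 1%g = 1 }.

Definition mobius_transform (f : valuation) (alpha : X) (c : {set Sigma}) : R :=
  \sum_(c' : {set Sigma} |
      is_clique I c' && (clique_trace I c <= clique_trace I c')%O)
    (-1) ^+ (#|c'| - #|c|) * val_fun f alpha (clique_trace I c').

Definition probabilistic (f : valuation) : Prop :=
  forall alpha,
    mobius_transform f alpha finset.set0 = 0 /\
    forall c : {set Sigma}, is_clique I c -> c != finset.set0 ->
      executions alpha (clique_trace I c) -> 0 <= mobius_transform f alpha c.

Definition dominant_fun (alpha : X) : trace I -> R :=
  indic (executions alpha).

Lemma dominant_ge0 alpha x : 0 <= dominant_fun alpha x.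
Proof. exact: ler0n. Qed.

Lemma dominant_in alpha x :
  act S (Some alpha) x <> None -> dominant_fun alpha x = 1.
Proof. by move=> ax; rewrite /dominant_fun indicE mem_set. Qed.

Lemma dominant_sink alpha x :
  act S (Some alpha) x = None -> dominant_fun alpha x = 0.
Proof. by move=> ax; rewrite /dominant_fun indicE memNset. Qed.

Lemma dominantM alpha beta x y :
  act S (Some alpha) x = Some beta -> act S (Some beta) y <> None ->
  dominant_fun alpha (x * y)%g = dominant_fun alpha x * dominant_fun beta y.
Proof.
by move=> ax bY; rewrite !dominant_in ?mul1r ?actM ?ax.
Qed.

Lemma dominant1 alpha : dominant_fun alpha 1%g = 1.
Proof. by rewrite dominant_in // act1. Qed.

Definition dominant : valuation :=
  {| val_fun := dominant_fun; val_ge0 := dominant_ge0;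
     val_sink := dominant_sink; valM := dominantM; val1 := dominant1 |}.

Definition thetaC : {poly R[i]} := map_poly intr theta.

(* [theta] has constant coefficient 1, so it is never the zero polynomial; the
   modulus is compared over all complex roots. *)
Definition is_characteristic_root (r : \bar R) : Prop :=
  match r with
  | EFin x => [/\ 0 < x, x <= 1, root thetaC (x%:C)%C &
               forall z, root thetaC z -> (x%:C)%C <= `|z|]
  | +oo%E => size theta = 1%N
  | -oo%E => False
  end.

Lemma characteristic_root_unique (r s : \bar R) :
  is_characteristic_root r -> is_characteristic_root s -> r = s.
Proof.
have const x : size theta = 1%N -> ~~ root thetaC x.
  move=> /eqP/size_poly1P[c c0 thE]; rewrite /thetaC thE map_polyC /=.
  by rewrite rootC intr_eq0.
case: r s => [r||] [s||] //=.
- move=> [r0 _ rr rmin] [s0 _ sr smin].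
  have := smin _ rr; have := rmin _ sr.
  rewrite !normc_def /= !expr0n !addr0 !sqrtr_sqr !gtr0_norm // !lecR.
  by move=> rs sr'; congr (_%:E)%E; apply/eqP; rewrite eq_le rs.
- by move=> [_ _ rr _] /const nr; rewrite (negPf (nr _)) in rr.
- by move=> /const nr [_ _]; rewrite (negPf (nr _)).
Qed.

End Valuations.
End ConcurrentSystem.

(* Main.v *)
(* The lattice condition amounts to a local diamond property: any two distinct
   letters enabled at a state commute and can be fired jointly.  Hence the
   cliques enabled at [alpha] are exactly the subsets of the set of enabled
   letters, and the Mobius transform of the dominant valuation is the indicator
   of that set.  Conversely, if the valuation is probabilistic, Mobius inversion
   at the empty clique and at a single letter [a] shows that the total mass 1 is
   already carried by the cliques containing [a]; so some live clique contains
   every enabled letter.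

   Under the diamond property, an execution is below another as soon as its
   letter counts are smaller, so an infinite execution is determined by its
   letter counts, which lie in a countable set.

   For the root, let [W s A] be the sum of [(-z)^|c| v (s.c)] over the subsets
   [c] of [A], a set of letters enabled at [s].  A kernel vector [v] of
   [mu(z)] satisfies [W s A = 0] when [A] is the full enabled set, and
   [W s (b |: A) = W s A - z W (s.b) A]; by downward induction on [#|A|], when
   [|z| < 1] the largest [|W s A|] is at most [|z|] times itself, so
   [v s = W s set0 = 0].  If some state cannot reach a terminal one, the
   indicator of such states is a kernel vector of [mu(1)]; otherwise [mu] is
   unitriangular for the length of the maximal execution, and [theta = 1]. *)
Require Import Defs.
From Stdlib Require Import Relation_Operators.
From mathcomp Require Import all_boot all_order all_algebra perm.
From mathcomp Require Import boolp classical_sets cardinality.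
From mathcomp Require Import reals constructive_ereal.
From mathcomp Require Import complex.

Set Implicit Arguments.
Unset Strict Implicit.
Unset Printing Implicit Defensive.

Import Order.TTheory GRing.Theory Num.Theory.

(** * Trace monoids: cancellation, Levi's lemma, bounded joins, meets, cliques *)

Section Traces.
Variables (Sigma : finType) (I : rel Sigma).
Hypotheses (I_sym : symmetric I) (I_irr : irreflexive I).
Implicit Types (a b : Sigma) (u v : seq Sigma) (x y z w : trace I).
Implicit Types (c d : {set Sigma}).

Local Notation letter := (letter I).
Local Notation clique_trace := (clique_trace I).

(** Decides whether some occurrence of [a] in [u] can be commuted to the front, that is, whether
    [letter a] divides the trace of [u]. *)
Fixpoint lead a u : bool :=
  if u is b :: u' then (b == a) || I a b && lead a u' else false.

Lemma lead_cat a u v : lead a (u ++ v) = lead a u || all (I a) u && lead a v.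
Proof. by elim: u => //= b u ->; case: (b == a); case: (I a b). Qed.

Lemma trace_eq_cons a u v : trace_eq I u v -> trace_eq I (a :: u) (a :: v).
Proof.
by move=> uv; apply: (@trace_eq_cat _ _ [:: a] [:: a]) => //; apply: rst_refl.
Qed.

(** Both invariants need checking only across a single swap. They are the source of left
    cancellation and of Levi's lemma. *)
Lemma trace_eq_lead a u v : trace_eq I u v ->
  lead a u = lead a v /\ trace_eq I (rem a u) (rem a v).
Proof.
elim=> {u v}.
- move=> _ _ [u v b c Ibc]; elim: u => [|d u [IH1 IH2]] /=; last first.
    rewrite IH1; split=> //; case: eqP => _; last exact: trace_eq_cons.
    by apply: rst_step; split.
  move: Ibc; have [-> | ba] := eqVneq b a; have [-> | ca] := eqVneq c a => /=.
  + by rewrite I_irr.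
  + by move=> ->; split=> //; apply: rst_refl.
  + by rewrite I_sym => ->; split=> //; apply: rst_refl.
  + move=> Ibc; rewrite andbCA; split=> //.
    by apply: rst_step; apply: (@Swap _ _ [::]).
- by split=> //; apply: rst_refl.
- by move=> u v _ [-> uv]; split=> //; apply: rst_sym.
- by move=> u v t _ [-> uv] _ [-> vw]; split=> //; apply: rst_trans uv vw.
Qed.

Lemma lead_rem a u : lead a u -> trace_eq I u (a :: rem a u).
Proof.
elim: u => //= b u IH; case: eqP => [-> _ | _ /= /andP[Iab /IH ua]].
  exact: rst_refl.
apply: (@rst_trans _ _ _ [:: b, a & rem a u]); first exact: trace_eq_cons.
by apply: rst_step; apply: (@Swap _ _ [::]); rewrite I_sym.
Qed.

(** Makes [clique_trace] insensitive to the order in which a clique is enumerated. *)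
Lemma independent_perm_trace_eq u v :
  {in u &, forall a b, a != b -> I a b} -> perm_eq u v -> trace_eq I u v.
Proof.
elim: u v => [|a u IH] v Iu uv.
  by move: uv; rewrite perm_sym => /perm_nilP ->; apply: rst_refl.
have av : a \in v by rewrite -(perm_mem uv) mem_head.
have leadv : lead a v.
  have : {in v, forall b, b != a -> I a b}.
    move=> b bv ba; apply: Iu; rewrite ?mem_head 1?eq_sym //.
    by rewrite (perm_mem uv).
  elim: v av {uv IH} => //= b v IH; rewrite inE eq_sym => + Iv.
  have [//|ba /= av] := eqVneq b a.
  by rewrite Iv ?mem_head // IH // => e ev; apply: Iv; rewrite inE ev orbT.
apply: rst_trans (rst_sym _ _ _ _ (lead_rem leadv)).
apply/trace_eq_cons/IH.
  by move=> b c bu cu; apply: Iu; rewrite inE ?bu ?cu orbT.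
by rewrite -(perm_cons a) (perm_trans uv) // perm_to_rem.
Qed.

Lemma word_trace_cons a u :
  word_trace I (a :: u) = (letter a * word_trace I u)%g.
Proof. exact: (@word_trace_cat _ I [:: a]). Qed.

Lemma trace_ind (P : trace I -> Prop) :
  P 1%g -> (forall a x, P x -> P (letter a * x)%g) -> forall x, P x.
Proof.
move=> P1 PM x; rewrite -(word_traceK x); elim: (repr x) => [//|a w IH].
by rewrite word_trace_cons; apply: PM.
Qed.

Lemma trace_wordE x : exists u, x = word_trace I u.
Proof. by exists (repr x); rewrite word_traceK. Qed.

Lemma trace_length1 : trace_length (1%g : trace I) = 0.
Proof. exact: trace_length_word. Qed.

Lemma trace_length_letter a : trace_length (letter a) = 1.
Proof. exact: trace_length_word. Qed.

Lemma letterI a x y : (letter a * x = letter a * y)%g -> x = y.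
Proof.
have [u ->] := trace_wordE x; have [v ->] := trace_wordE y.
rewrite -!word_trace_cons => /word_trace_eqP/(trace_eq_lead a)[_ /=].
by rewrite eqxx => /word_trace_eqP.
Qed.

Lemma trace_mulI x : injective (fun y => x * y)%g.
Proof.
elim/trace_ind: x => [|a x IH] y z /=; first by rewrite !mul1g.
by rewrite -!mulgA => /letterI/IH.
Qed.

Lemma letterC a b : I a b -> (letter a * letter b = letter b * letter a)%g.
Proof.
move=> Iab; rewrite -!word_trace_cons; apply/word_trace_eqP.
by apply: rst_step; apply: (@Swap _ _ [::] [::]).
Qed.

(** The right side has [a] as a possible first letter; since [a != b], this [a] comes from [y] and
    commutes with [b]. The witness is [y] with its first [a] removed. *)
Lemma letter_levi a b x y : a != b -> (letter a * x = letter b * y)%g ->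
  I a b /\ exists z, (x = letter b * z /\ y = letter a * z)%g.
Proof.
have [v ->] := trace_wordE y; have [u ->] := trace_wordE x.
rewrite -!word_trace_cons => ab /word_trace_eqP uv.
have [/=+ _] := trace_eq_lead a uv; rewrite eqxx eq_sym (negPf ab) /=.
move/esym=> /andP[Iab /lead_rem va]; split=> //.
have /word_trace_eqP := va; rewrite word_trace_cons => {}va.
exists (word_trace I (rem a v)); split=> //.
apply: (@letterI a); move/word_trace_eqP: uv; rewrite !word_trace_cons => ->.
by rewrite va !mulgA (letterC Iab).
Qed.

Lemma le_mul2 x y z : ((x * y)%g <= (x * z)%g)%O = (y <= z)%O.
Proof.
apply/trace_leP/trace_leP => [] [t].
  by rewrite -mulgA => /trace_mulI ->; exists t.
by move=> ->; exists t; rewrite mulgA.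
Qed.

Lemma le_mulr x y : (x <= (x * y)%g)%O.
Proof. by apply/trace_leP; exists y. Qed.

Lemma le_1 x : ((1%g : trace I) <= x)%O.
Proof. by apply/trace_leP; exists x; rewrite mul1g. Qed.

Lemma le_length x y : (x <= y)%O -> trace_length x <= trace_length y.
Proof. by case/trace_leP=> z ->; rewrite trace_lengthM leq_addr. Qed.

Lemma letter_le_mul a x y : (letter a <= (x * y)%g)%O ->
  (letter a <= x)%O \/ {in repr x, forall b, I a b} /\ (letter a <= y)%O.
Proof.
have leadP (w : seq Sigma) : (letter a <= word_trace I w)%O = lead a w.
  apply/trace_leP/idP => [[z]|/lead_rem/word_trace_eqP].
    have [v ->] := trace_wordE z; rewrite -word_trace_cons.
    by case/word_trace_eqP/(trace_eq_lead a)=> -> /=; rewrite eqxx.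
  by rewrite word_trace_cons => ->; exists (word_trace I (rem a w)).
rewrite [X in (_ <= X)%O -> _](_ : _ = word_trace I (repr x ++ repr y)) //.
rewrite leadP lead_cat -!leadP !word_traceK.
by case/orP=> [|/andP[/allP]]; [left|right].
Qed.

(** Induction on the length of the bound. Equal first letters cancel. If the first letters are
    distinct, Levi's lemma gives [z = a b t]. The join of the rest of [x] with [b] is some [b k1],
    that of the rest of [y] with [a] is some [a k2]; both [k1] and [k2] lie below [t], and [a b]
    times their join is the join sought. *)
Lemma bounded_join x y z : (x <= z)%O -> (y <= z)%O ->
  exists j : trace I, forall w : trace I, (j <= w)%O = (x <= w)%O && (y <= w)%O.
Proof.
have [n] := ubnP (trace_length z); elim: n x y z => // n IH x y z zn.
elim/trace_ind: x => [|a x _]; first by exists y => w; rewrite le_1.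
elim/trace_ind: y => [|b y _].
  by exists (letter a * x)%g => w; rewrite le_1 andbT.
have leM e t (w : trace I) : ((letter e * t)%g <= w)%O ->
    exists w', w = (letter e * w')%g.
  by case/trace_leP=> r ->; exists (t * r)%g; rewrite mulgA.
move=> xz yz; have [z1 z1E] := leM _ _ _ xz; have [z2 z2E] := leM _ _ _ yz.
have z1n : trace_length z1 < n.
  by move: zn; rewrite z1E trace_lengthM trace_length_letter.
have z2n : trace_length z2 < n.
  by move: zn; rewrite z2E trace_lengthM trace_length_letter.
move: xz yz; rewrite {1}z1E z2E !le_mul2 => xz1 yz2.
have [ab|ab] := eqVneq a b.
  subst b; have z12 : z1 = z2 by apply: (@letterI a); rewrite -z1E -z2E.
  subst z2; have [j jP] := IH _ _ _ z1n xz1 yz2; exists (letter a * j)%g => w.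
  apply/idP/andP=> [aj|[ax ay]].
    have [w' wE] := leM _ _ _ aj; move: aj; rewrite wE !le_mul2 jP.
    by move/andP.
  have [w' wE] := leM _ _ _ ax; move: ax ay; rewrite wE !le_mul2 jP.
  by move=> -> ->.
have [Iab [t [z1t z2t]]] := letter_levi ab (etrans (esym z1E) z2E).
have tn : trace_length t < n.
  by apply: leq_ltn_trans z1n; rewrite z1t trace_lengthM leq_addl.
have bz1 : (letter b <= z1)%O by rewrite z1t le_mulr.
have az2 : (letter a <= z2)%O by rewrite z2t le_mulr.
have [j1 j1P] := IH _ _ _ z1n xz1 bz1.
have [j2 j2P] := IH _ _ _ z2n yz2 az2.
have /andP[xj1 bj1] : (x <= j1)%O && (letter b <= j1)%O by rewrite -j1P.
have /andP[yj2 aj2] : (y <= j2)%O && (letter a <= j2)%O by rewrite -j2P.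
have [k1 k1E] := trace_leP _ _ bj1; have [k2 k2E] := trace_leP _ _ aj2.
have k1t : (k1 <= t)%O by rewrite -(le_mul2 (letter b)) -k1E -z1t j1P xz1.
have k2t : (k2 <= t)%O by rewrite -(le_mul2 (letter a)) -k2E -z2t j2P yz2.
have [j jP] := IH _ _ _ tn k1t k2t.
have /andP[k1j k2j] : (k1 <= j)%O && (k2 <= j)%O by rewrite -jP.
exists (letter a * (letter b * j))%g => w; apply/idP/andP=> [jw|[axw byw]].
  split; apply: le_trans jw.
    by rewrite le_mul2 (le_trans xj1) // k1E le_mul2.
  rewrite mulgA letterC // -mulgA le_mul2 (le_trans yj2) // k2E.
  by rewrite le_mul2.
have [w1 w1E] := leM _ _ _ axw; have [w2 w2E] := leM _ _ _ byw.
have [_ [t' [w1t w2t]]] := letter_levi ab (etrans (esym w1E) w2E).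
rewrite w1E w1t !le_mul2 jP.
rewrite -(le_mul2 (letter b)) -k1E -w1t j1P.
rewrite -(le_mul2 (letter a) k2) -k2E -w2t j2P.
move: axw byw; rewrite {1}w1E w2E !le_mul2 => -> ->.
by rewrite w1t w2t !le_mulr.
Qed.

(** Take a common lower bound [m] of maximal length. For any other one, [w], the join of [w] and [m]
    exists below [x], is again a common lower bound, and hence equals [m]. *)
Lemma trace_meet x y :
  exists m : trace I, forall w : trace I, (w <= m)%O = (w <= x)%O && (w <= y)%O.
Proof.
pose P n := `[< exists m : trace I,
  [/\ (m <= x)%O, (m <= y)%O & trace_length m = n] >].
have P0 : exists n, P n.
  by exists 0; apply/asboolP; exists 1%g; rewrite !le_1 trace_length1.
have Pub n : P n -> n <= trace_length x.
  by case/asboolP=> m [mx _ <-]; apply: le_length.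
case: (ex_maxnP P0 Pub) => n /asboolP[m [mx my mn]] nmax.
exists m => w; apply/idP/andP=> [wm|[wx wy]]; first by rewrite !(le_trans wm).
have [j jP] := bounded_join wx mx.
have /andP[wj mj] : (w <= j)%O && (m <= j)%O by rewrite -jP.
have jx : (j <= x)%O by rewrite jP wx mx.
have jy : (j <= y)%O by rewrite jP wy my.
have /nmax : P (trace_length j) by apply/asboolP; exists j.
have [k jE] := trace_leP _ _ mj; rewrite -mn jE trace_lengthM.
rewrite -[X in _ <= X]addn0 leq_add2l leqn0 => /eqP/trace_length0 k1.
by move: wj; rewrite jE k1 mulg1.
Qed.

Definition trace_count a x : nat := count_mem a (repr x).

Lemma trace_count_word a (w : seq Sigma) :
  trace_count a (word_trace I w) = count_mem a w.
Proof.
apply/seq.permP/(@trace_eq_perm _ I).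
by apply/word_trace_eqP; rewrite word_traceK.
Qed.

Lemma trace_countM a x y :
  trace_count a (x * y)%g = trace_count a x + trace_count a y.
Proof. by rewrite [LHS]trace_count_word count_cat. Qed.

Lemma trace_count1 a : trace_count a 1%g = 0.
Proof. exact: trace_count_word. Qed.

Lemma trace_count_letter a b : trace_count a (letter b) = (b == a).
Proof. by rewrite [LHS]trace_count_word /= addn0. Qed.

Lemma trace_count_le a x y : (x <= y)%O -> trace_count a x <= trace_count a y.
Proof. by case/trace_leP=> z ->; rewrite trace_countM leq_addr. Qed.

Lemma trace_count_clique a c : trace_count a (clique_trace c) = (a \in c).
Proof.
by rewrite [LHS]trace_count_word count_uniq_mem ?enum_uniq // mem_enum.
Qed.

Lemma is_cliqueP c :
  reflect {in c &, forall a b, a != b -> I a b} (is_clique I c).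
Proof.
apply: (iffP forall_inP) => [H a b ac bc|H a ac].
  by have /forall_inP/(_ b bc)/implyP := H a ac.
by apply/forall_inP => b bc; apply/implyP; apply: H.
Qed.

Lemma is_cliqueS c d : c \subset d -> is_clique I d -> is_clique I c.
Proof.
move=> /fintype.subsetP cd /is_cliqueP dI; apply/is_cliqueP => a b ac bc.
by apply: dI; apply: cd.
Qed.

Lemma clique_trace0 : clique_trace finset.set0 = 1%g.
Proof. by rewrite /Defs.clique_trace enum_set0. Qed.

Lemma clique_traceU c d : [disjoint c & d] -> is_clique I (c :|: d) ->
  clique_trace (c :|: d) = (clique_trace c * clique_trace d)%g.
Proof.
move=> cd /is_cliqueP cdI; rewrite [RHS]/= -[RHS]word_trace_cat.
apply/word_trace_eqP/independent_perm_trace_eq.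
  by move=> a b; rewrite !mem_enum; apply: cdI.
apply: uniq_perm; rewrite ?enum_uniq //.
  rewrite cat_uniq !enum_uniq andbT /=; apply/hasPn => a; rewrite !mem_enum.
  by move=> ad; apply/negP => ac; rewrite (disjointFr cd ac) in ad.
by move=> a; rewrite mem_cat !mem_enum inE.
Qed.

Lemma clique_trace1 a : clique_trace [set a] = letter a.
Proof. by rewrite /Defs.clique_trace enum_set1. Qed.

Lemma clique_traceU1 a c : a \notin c -> is_clique I (a |: c) ->
  clique_trace (a |: c) = (letter a * clique_trace c)%g.
Proof.
by move=> ac aI; rewrite clique_traceU ?clique_trace1 // disjoints1.
Qed.

Lemma clique_trace_le c d : is_clique I d ->
  (clique_trace c <= clique_trace d)%O = (c \subset d).
Proof.
move=> dI; apply/idP/idP => [cd|cd].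
  apply/fintype.subsetP => a ac; have := trace_count_le a cd.
  by rewrite !trace_count_clique ac; case: (a \in d).
have dE : d = c :|: (d :\: c).
  by rewrite -{1}(finset.setID d c) (finset.setIidPr cd).
rewrite [X in (_ <= clique_trace X)%O]dE clique_traceU ?le_mulr -?dE //.
by rewrite -finset.setI_eq0 finset.setIDA finset.setDIl
  finset.setDv finset.set0I.
Qed.

Lemma letter_le_clique a c : is_clique I c ->
  (letter a <= clique_trace c)%O = (a \in c).
Proof. by move=> cI; rewrite -clique_trace1 clique_trace_le // finset.sub1set. Qed.

End Traces.

(** * The lattice condition and the diamond property *)

Section Systems.
Variables (Sigma : finType) (I : rel Sigma) (X : finType).
Hypotheses (I_sym : symmetric I) (I_irr : irreflexive I).
Variable S : concurrent_system I X.
Implicit Types (s : option X) (a b : Sigma) (x y z : trace I).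
Implicit Types (c d : {set Sigma}).

Local Notation letter := (letter I).
Local Notation clique_trace := (clique_trace I).

(** Taken on [option X], so that it composes with [act] without a case analysis; nothing is live at
    the sink. *)
Definition live s x : bool := act S s x != None.

Definition live_letters s : {set Sigma} := finset (fun a => live s (letter a)).

Definition diamond : Prop := forall s a b, a != b ->
  live s (letter a) -> live s (letter b) ->
  I a b /\ live (act S s (letter a)) (letter b).

Lemma executionsP alpha x : executions S alpha x <-> live (Some alpha) x.
Proof. by split=> /eqP. Qed.

Lemma liveM s x y : live s (x * y)%g = live (act S s x) y.
Proof. by rewrite /live actM. Qed.

Lemma live1 s : live s 1%g = (s != None).
Proof. by rewrite /live act1. Qed.

Lemma live_act s x : live s x -> act S s x != None.
Proof. by []. Qed.

Lemma live_le s x y : (x <= y)%O -> live s y -> live s x.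
Proof.
case/trace_leP=> z ->; rewrite /live actM.
by apply: contraNN => /eqP->; rewrite act_sink.
Qed.

Lemma live_state s x : live s x -> s != None.
Proof. by move/(live_le (le_1 x)); rewrite live1. Qed.

(** The join of [a] and [b] among the executions starts with both letters, so by Levi's lemma they
    commute and their product divides it. *)
Lemma deterministic_diamond : deterministic S -> diamond.
Proof.
move=> det [alpha|] a b ab; last by rewrite /live act_sink.
move=> /executionsP la /executionsP lb.
have [[j /executionsP lj jP] _] := det alpha _ _ la lb.
have := jP j (proj2 (executionsP _ _) lj); rewrite lexx.
case/esym/andP=> /trace_leP[x jx] /trace_leP[y jy].
have [Iab [z [xE _]]] := letter_levi I_sym I_irr ab (etrans (esym jx) jy).
split=> //; rewrite -liveM; apply: live_le lj.
by rewrite jx xE mulgA le_mulr.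
Qed.

Section Diamond.
Hypothesis diaS : diamond.

(** The letter [a] is pushed through [x]: each letter met either equals [a] or, by the diamond,
    commutes with [a] and leaves it enabled. *)
Lemma diamond_letter_ub s a x : live s (letter a) -> live s x ->
  exists z, [/\ (letter a <= z)%O, (x <= z)%O & live s z].
Proof.
elim/trace_ind: x s => [|b x IH] s la lx.
  by exists (letter a); rewrite lexx le_1.
have [ab|ab] := eqVneq a b.
  by exists (letter b * x)%g; rewrite ab lexx le_mulr.
have lb : live s (letter b) by apply: live_le lx; apply: le_mulr.
have ba : b != a by rewrite eq_sym.
have [Iba la'] := diaS ba lb la.
have [|z [az xz lz]] := IH _ la'; first by rewrite -liveM.
exists (letter b * z)%g; rewrite liveM le_mul2 // xz; split=> //.
have [t zE] := trace_leP _ _ az.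
by rewrite zE mulgA (letterC Iba) -mulgA le_mulr.
Qed.

(** The first letter [a] of [y] and [x] have a bound [a t]; by induction [t] and the rest of [y] are
    then bounded from the state after [a]. *)
Lemma diamond_ub s x y : live s x -> live s y ->
  exists z, [/\ (x <= z)%O, (y <= z)%O & live s z].
Proof.
elim/trace_ind: y s x => [|a y IH] s x lx ly.
  by exists x; rewrite lexx le_1.
have la : live s (letter a) by apply: live_le ly; apply: le_mulr.
have [z [/trace_leP[t zE] xz lz]] := diamond_letter_ub la lx.
have [||w [tw yw lw]] := IH (act S s (letter a)) t; rewrite -?liveM -?zE //.
exists (letter a * w)%g; rewrite liveM le_mul2 //; split=> //.
by apply: le_trans xz _; rewrite zE le_mul2.
Qed.

Lemma diamond_deterministic : deterministic S.
Proof.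
move=> alpha x y /executionsP lx /executionsP ly; split.
  have [z [xz yz lz]] := diamond_ub lx ly.
  have [j jP] := bounded_join I_sym I_irr xz yz.
  exists j => [|w _]; last exact: jP.
  by apply/executionsP; apply: live_le lz; rewrite jP xz.
have [m mP] := trace_meet I_sym I_irr x y.
have /andP[mx _] : (m <= x)%O && (m <= y)%O by rewrite -mP.
exists m => [|w _]; last exact: mP.
by apply/executionsP; apply: live_le lx.
Qed.

Lemma diamond_clique s c : s != None -> c \subset live_letters s ->
  is_clique I c /\ live s (clique_trace c).
Proof.
move=> s0 cs; have cI : is_clique I c.
  apply/is_cliqueP => a b /(fintype.subsetP cs) + /(fintype.subsetP cs).
  by rewrite !inE => la lb ab; have [] := diaS ab la lb.
split=> //; have [n] := ubnP #|c|.
elim: n s c s0 cs cI => // n IH s c s0 cs cI cn.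
have [->|[a ac]] := set_0Vmem c; first by rewrite clique_trace0 live1.
have cE : c = a |: (c :\ a) by rewrite finset.setD1K.
have la : live s (letter a) by have := fintype.subsetP cs a ac; rewrite inE.
rewrite cE clique_traceU1 -?cE ?setD11 // liveM; apply: IH => //.
- apply/fintype.subsetP => b; rewrite !inE => /andP[ba bc].
  have := fintype.subsetP cs b bc; rewrite inE => lb.
  by rewrite eq_sym in ba; have [] := diaS ba la lb.
- by apply: is_cliqueS cI; apply: finset.subD1set.
- by rewrite (cardsD1 a c) ac in cn.
Qed.

(** The first letter of [x] is enabled and occurs in [y]; by the diamond it commutes with all that
    precedes it in [y], so it can be cancelled on both sides. *)
Lemma diamond_count_le s x y : live s x -> live s y ->
  (forall a, trace_count a x <= trace_count a y) -> (x <= y)%O.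
Proof.
elim/trace_ind: x s y => [|a x IH] s y lx ly xy; first exact: le_1.
have la : live s (letter a) by apply: live_le lx; apply: le_mulr.
have /trace_leP[t yE] : (letter a <= y)%O.
  have: 0 < trace_count a y.
    by apply: leq_trans (xy a); rewrite trace_countM trace_count_letter eqxx.
  elim/trace_ind: y s ly la {lx xy} => [|b y IHy] s; first by rewrite trace_count1.
  move=> ly la; have [->|ab] := eqVneq a b; first by rewrite le_mulr.
  have lb : live s (letter b) by apply: live_le ly; apply: le_mulr.
  have ba : b != a by rewrite eq_sym.
  rewrite trace_countM trace_count_letter (negPf ba) add0n => ay.
  have [Iba la'] := diaS ba lb la.
  have ly' : live (act S s (letter b)) y by rewrite -liveM.
  have /trace_leP[t ->] := IHy _ ly' la' ay.
  by rewrite mulgA (letterC Iba) -mulgA le_mulr.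
subst y; rewrite le_mul2 //; apply: (IH (act S s (letter a))); rewrite -?liveM //.
by move=> b; have := xy b; rewrite !trace_countM leq_add2l.
Qed.

(** A common upper bound of [x] and [y] extends [x], and nothing can be fired after [x]. *)
Lemma terminal_max s x y : live s x -> live_letters (act S s x) = finset.set0 ->
  live s y -> (y <= x)%O.
Proof.
move=> lx term ly; have [z [/trace_leP[t zE] yz lz]] := diamond_ub lx ly.
move: yz lz; rewrite {}zE; elim/trace_ind: t => [|a t _]; first by rewrite mulg1.
move=> _; rewrite liveM => /(live_le (le_mulr _ _)) la.
by have := finset.in_set0 a; rewrite -term inE la.
Qed.

End Diamond.

Lemma clique_live_sub s c : is_clique I c -> live s (clique_trace c) ->
  c \subset live_letters s.
Proof.
move=> cI lc; apply/fintype.subsetP => a ac; rewrite inE; apply: live_le lc.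
by rewrite letter_le_clique.
Qed.

End Systems.

(** * Alternating sums over sets *)

Section AlternatingSums.
Local Open Scope ring_scope.
Variables (T : finType).
Implicit Types (b : T) (c d e : {set T}).

(** Pairs each set avoiding [b] with the set obtained by adding [b]. *)
Lemma big_toggle (V : nmodType) (P : pred {set T}) (F : {set T} -> V) b :
  (forall c, b \notin c -> P (b |: c) = P c) ->
  \sum_(c | P c) F c = \sum_(c | P c && (b \notin c)) (F c + F (b |: c)).
Proof.
move=> Pb; rewrite (bigID (fun c => b \notin c)) /= big_split /=; congr (_ + _).
rewrite (reindex_onto (fun c => b |: c) (fun c => c :\ b)) /=; last first.
  by move=> c /andP[_]; rewrite negbK => /finset.setD1K.
apply: eq_bigl => c; rewrite setU11 andbT.
have [bc|bc] /= := boolP (b \in c); last by rewrite finset.setU1K // eqxx !andbT Pb.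
rewrite andbF; apply/andP => -[_ /eqP cE].
by move: bc; rewrite -cE setD11.
Qed.

Lemma sign_subn (K : pzRingType) m n : (n <= m)%N ->
  (-1) ^+ (m - n) = (-1) ^+ m * (-1) ^+ n :> K.
Proof.
by move=> nm; rewrite -{2}(subnK nm) exprD -mulrA -expr2 sqrr_sign mulr1.
Qed.

Lemma alternating_sum (K : pzRingType) c d : c \subset d ->
  \sum_(e : {set T} | (c \subset e) && (e \subset d)) (-1) ^+ #|e| =
    (c == d)%:R * (-1) ^+ #|c| :> K.
Proof.
move=> cd; have [<-|ncd] := eqVneq c d.
  rewrite mul1r; apply: big_pred1 => e; rewrite andbC.
  exact/esym/finset.eqEsubset.
have /fintype.subsetPn[b bd bc] : ~~ (d \subset c).
  by apply: contra ncd => dc; rewrite finset.eqEsubset cd.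
rewrite mul0r (@big_toggle _ _ _ b) => [|e be].
  by apply: big1 => e /andP[_ be]; rewrite cardsU1 be exprS mulN1r subrr.
rewrite finset.subUset finset.sub1set bd; congr (_ && _).
by rewrite -[in RHS](finset.setU1K be) finset.subsetD1 bc andbT.
Qed.

End AlternatingSums.

(** * The dominant valuation and its Mobius transform *)

Section Dominant.
Local Open Scope ring_scope.
Variables (R : realType) (Sigma : finType) (I : rel Sigma) (X : finType).
Hypotheses (I_sym : symmetric I) (I_irr : irreflexive I).
Variable S : concurrent_system I X.

Lemma dominant_funE alpha x :
  dominant_fun S R alpha x = (live S (Some alpha) x)%:R.
Proof.
rewrite /live; case: eqP => [ax|ax]; first by rewrite dominant_sink.
by rewrite dominant_in.
Qed.

(** After exchanging the sums, the coefficient of [e] is an alternating sum over the interval from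
    [c] to [e], zero unless [e] is [c]. *)
Lemma mobius_inversion (f : valuation S R) alpha c : is_clique I c ->
  \sum_(d : {set Sigma} | is_clique I d && (c \subset d))
    mobius_transform f alpha d = val_fun f alpha (clique_trace I c).
Proof.
move=> cI; rewrite (exchange_big_dep
  (fun e => is_clique I e && (c \subset e))) /=; last first.
  move=> d e /andP[dI cd] /andP[eI]; rewrite eI clique_trace_le //.
  exact: fintype.subset_trans.
rewrite (bigD1 c) ?cI //= [X in _ + X]big1 ?addr0 => [|e /andP[/andP[eI ce] ec]].
  rewrite (big_pred1 c) ?subnn ?mul1r // => d.
  rewrite clique_trace_le //=; apply/andP/eqP => [[/andP[_ cd] dc]|->].
    by apply/eqP; rewrite finset.eqEsubset dc.
  by rewrite cI fintype.subxx.
rewrite -mulr_suml (eq_bigl (fun d : {set Sigma} =>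
  (c \subset d) && (d \subset e))); last first.
  move=> d; rewrite eI clique_trace_le //=.
  have [de|] := boolP (d \subset e); rewrite ?andbF ?andbT //.
  by rewrite (is_cliqueS de eI).
under eq_bigr => d /andP[_ de] do rewrite sign_subn ?subset_leq_card //.
by rewrite -mulr_sumr alternating_sum // eq_sym (negPf ec) mul0r mulr0 mul0r.
Qed.

Lemma diamond_probabilistic : (forall alpha, enabled S alpha <> finset.set0) ->
  diamond S -> probabilistic (dominant S R).
Proof.
move=> en0 diaS alpha.
have hE (c : {set Sigma}) : c \subset enabled S alpha ->
    mobius_transform (dominant S R) alpha c = (c == enabled S alpha)%:R.
  move=> cs; rewrite /mobius_transform.
  under eq_bigr do rewrite /= dominant_funE mulrC mulr_natl mulrb.
  rewrite -big_mkcondr /=.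
  rewrite (eq_bigl (fun d : {set Sigma} =>
      (c \subset d) && (d \subset enabled S alpha))).
    under eq_bigr => d /andP[cd _] do rewrite sign_subn ?subset_leq_card //.
    by rewrite -mulr_suml alternating_sum // -mulrA -expr2 sqrr_sign mulr1.
  move=> d; apply/andP/andP => [[/andP[dI]]|[cd ds]].
    by rewrite clique_trace_le // => -> /(clique_live_sub I_sym dI).
  have [//|dI ->] := diamond_clique I_sym diaS (s := Some alpha) _ ds.
  by rewrite dI clique_trace_le.
split=> [|c cI _ /executionsP lc].
  (* The transform at the empty clique would be 1 if no letter were enabled; [en0] excludes this. *)
  by rewrite hE ?finset.sub0set // eq_sym; case: eqP (en0 alpha).
by rewrite hE ?ler0n //; apply: (clique_live_sub I_sym).
Qed.

Lemma probabilistic_diamond : probabilistic (dominant S R) -> diamond S.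
Proof.
move=> prob [alpha|] a b ab; last by rewrite /live act_sink.
move=> la lb; have [h0 hpos] := prob alpha.
pose h := mobius_transform (dominant S R) alpha.
(* A clique above a dead one is dead, so all terms of the transform vanish. *)
have h_live c : h c != 0 -> live S (Some alpha) (clique_trace I c).
  apply: contraNT => lc; apply/eqP; apply: big1 => d /andP[dI cd] /=.
  rewrite dominant_funE; case: (boolP (live _ _ _)) => [/(live_le cd)|_].
    by rewrite (negPf lc).
  by rewrite mulr0.
(* Nonnegativity is extended to the empty clique and to dead cliques, where [h] is 0. *)
have h_ge0 c : is_clique I c -> 0 <= h c.
  move=> cI; have [->|hc] := eqVneq (h c) 0; first exact: lexx.
  apply: hpos => //; last exact/executionsP/h_live.
  by apply: contraNneq hc => ->; rewrite /h h0.
have h_sum : \sum_(c : {set Sigma} | is_clique I c) h c = 1.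
  have := mobius_inversion (dominant S R) alpha (c := finset.set0).
  rewrite /= clique_trace0 dominant1 => <-.
    by apply: eq_bigl => c; rewrite finset.sub0set andbT.
  by apply/is_cliqueP => e1 e2; rewrite inE.
have h_mem e : live S (Some alpha) (letter I e) ->
    forall c, is_clique I c -> h c != 0 -> e \in c.
  move=> le.
  have h_in : \sum_(c : {set Sigma} | is_clique I c && (e \in c)) h c = 1.
    have := mobius_inversion (dominant S R) alpha (c := [set e]).
    rewrite /= clique_trace1 dominant_funE le mulr1n => <-.
      by apply: eq_bigl => c; rewrite finset.sub1set.
    by apply/is_cliqueP => e1 e2; rewrite !inE => /eqP-> /eqP->; rewrite eqxx.
  (* The cliques avoiding [e] have total mass 0 and nonnegative masses, so each mass is 0. *)
  have := h_sum; rewrite (bigID (fun c : {set Sigma} => e \in c)) /= h_in.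
  rewrite -[RHS]addr0 => /addrI h_out c cI.
  apply: contraNT => ec; apply/eqP; move: h_out.
  move/psumr_eq0P; apply; last by rewrite cI.
  by move=> d /andP[dI _]; apply: h_ge0.
have [c /andP[cI hc]] : exists c, is_clique I c && (h c != 0).
  apply/existsP; apply: contraT => /existsPn hn.
  have : \sum_(c : {set Sigma} | is_clique I c) h c = 0.
    by apply: big1 => c cI; apply/eqP; have := hn c; rewrite cI negbK.
  by move/eqP; rewrite h_sum oner_eq0.
have ac := h_mem a la c cI hc; have bc := h_mem b lb c cI hc.
have abI : is_clique I (a |: [set b]).
  by apply: is_cliqueS cI; rewrite finset.subUset !finset.sub1set ac.
split; first by move/is_cliqueP: cI; apply.
rewrite -liveM -(clique_trace1 I b) -clique_traceU1 ?inE //.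
apply: live_le (h_live _ hc); rewrite clique_trace_le //.
by rewrite finset.subUset !finset.sub1set ac.
Qed.

End Dominant.

(** * Countability of the infinite executions *)

Section InfiniteExecutions.
Variables (Sigma : finType) (I : rel Sigma) (X : finType).
Hypotheses (I_sym : symmetric I) (I_irr : irreflexive I).
Variable S : concurrent_system I X.
Implicit Types (xi eta : nat -> {set Sigma}) (a : Sigma).

Definition prefix xi n : trace I := (\big[*%g/1]_(i < n) clique_trace I (xi i))%g.

Lemma prefixSl xi n : prefix xi n.+1 =
  (clique_trace I (xi 0) * prefix (fun i => xi i.+1) n)%g.
Proof. by rewrite /prefix big_ord_recl. Qed.

Lemma prefixSr xi n : prefix xi n.+1 = (prefix xi n * clique_trace I (xi n))%g.
Proof. by rewrite /prefix big_ord_recr. Qed.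

Lemma prefix_le xi n m : n <= m -> (prefix xi n <= prefix xi m)%O.
Proof.
elim: m => [|m IH]; first by rewrite leqn0 => /eqP->.
rewrite leq_eqVlt => /predU1P[->//|/IH nm].
by apply: le_trans nm _; rewrite prefixSr le_mulr.
Qed.

Lemma prefix_live xi n alpha : infinite_executions S alpha xi ->
  live S (Some alpha) (prefix xi n).
Proof.
case=> [[[xiC xiN] _] ex]; apply/executionsP/ex.
(* Cutting [xi] after [n] cliques gives the padded normal form of [prefix xi n]. *)
exists (fun i => if i < n then xi i else finset.set0); last first.
  by move=> i; case: ifP => // _; apply: finset.sub0set.
split.
  split=> i; first by case: ifP => // _; apply/is_cliqueP => a b; rewrite inE.
  have [iltn|_] := ltnP i.+1 n; first by rewrite (ltnW iltn).
  by apply/forall_inP => b; rewrite inE.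
exists n; split=> [i|]; first by rewrite leqNgt => /negPf->.
by apply: eq_bigr => i _; rewrite ltn_ord.
Qed.

Lemma generalised_trace_shift xi : generalised_trace I xi ->
  generalised_trace I (fun i => xi i.+1).
Proof. by case. Qed.

(** If [a] came from beyond the first clique, it would by induction lie in the second one, hence
    depend on some letter of the first, and could not commute past it. *)
Lemma letter_le_prefix xi n a : generalised_trace I xi ->
  (letter I a <= prefix xi n)%O -> a \in xi 0.
Proof.
elim: n xi => [|n IH] xi xiG.
  rewrite /prefix big_ord0 => /(trace_count_le a).
  by rewrite trace_count1 trace_count_letter eqxx.
rewrite prefixSl => /(letter_le_mul I_sym I_irr)[|[indep]].
  by rewrite letter_le_clique //; case: xiG.
move/(IH _ (generalised_trace_shift xiG)) => a1; case: xiG => _ /(_ 0).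
case/forall_inP/(_ a a1)/exists_inP => b b0.
rewrite I_sym indep // -has_pred1 has_count.
by rewrite -[count _ _]/(trace_count b _) trace_count_clique b0.
Qed.

Definition dominated xi eta : Prop :=
  forall n, exists m, (prefix xi n <= prefix eta m)%O.

Lemma dominated_head xi eta : generalised_trace I xi -> generalised_trace I eta ->
  dominated xi eta -> xi 0 \subset eta 0.
Proof.
move=> [xiC _] etaG /(_ 1)[m le_m]; apply/fintype.subsetP => a a0.
apply: (letter_le_prefix (n := m) etaG); apply: le_trans le_m.
by rewrite /prefix big_ord1 letter_le_clique.
Qed.

Lemma dominated_shift xi eta : xi 0 = eta 0 -> dominated xi eta ->
  dominated (fun i => xi i.+1) (fun i => eta i.+1).
Proof.
move=> e0 dom n; have [m le_m] := dom n.+1; exists m.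
rewrite -(le_mul2 I_sym I_irr (clique_trace I (xi 0))).
rewrite -prefixSl {1}e0 -prefixSl.
by apply: le_trans le_m _; apply: prefix_le.
Qed.

(** Mutual domination forces equal first cliques; cancelling them preserves domination of the
    tails. *)
Lemma dominated_antisym xi eta : generalised_trace I xi -> generalised_trace I eta ->
  dominated xi eta -> dominated eta xi -> xi = eta.
Proof.
move=> xiG etaG xe ex; apply/funext => i.
elim: i xi eta xiG etaG xe ex => [|i IH] xi eta xiG etaG xe ex;
  have e0 : xi 0 = eta 0 by apply/eqP; rewrite finset.eqEsubset !dominated_head.
  by [].
apply: (IH (fun i => xi i.+1) (fun i => eta i.+1)).
- exact: generalised_trace_shift.
- exact: generalised_trace_shift.
- exact: dominated_shift.
- exact: dominated_shift.
Qed.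

(* Limits of nondecreasing sequences, with [None] for infinity. *)
Definition nat_limit (u : nat -> nat) : option nat :=
  if pselect (exists k, (forall n, u n <= k) /\ exists n, k <= u n) is left e
  then Some (projT1 (cid e)) else None.

Lemma nat_limit_le u v : nat_limit u = nat_limit v ->
  forall n, exists m, u n <= v m.
Proof.
rewrite /nat_limit; case: pselect => [eu|nu]; case: pselect => [ev|nv] //=.
  case: (cid eu) (cid ev) => k [uk _] [l [_ [m vm]]] /= [kl] n.
  by exists m; apply: leq_trans (uk n) _; rewrite kl.
(* Without an attained maximum, [v] passes every level: a level reached but never exceeded would be
   one. *)
move=> _ n; elim: (u n) => [|k [m km]]; first by exists 0.
have [[m' km']|none] := pselect (exists m', k < v m'); first by exists m'.
case: nv; exists k; split; last by exists m.
by move=> m'; rewrite leqNgt; apply/negP => km'; apply: none; exists m'.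
Qed.

Lemma countable_infinite_executions : diamond S ->
  forall alpha, countable (infinite_executions S alpha).
Proof.
move=> diaS alpha.
pose code xi : {ffun Sigma -> option nat} :=
  [ffun a => nat_limit (fun n => trace_count a (prefix xi n))].
have code_dom xi eta : infinite_executions S alpha xi ->
    infinite_executions S alpha eta -> code xi = code eta -> dominated xi eta.
  move=> xiX etaX /ffunP ce n.
  have /choice[m mP] : forall a, exists m,
      trace_count a (prefix xi n) <= trace_count a (prefix eta m).
    by move=> a; have := ce a; rewrite !ffunE => /nat_limit_le/(_ n).
  (* Prefixes increase, so the largest of the indices serves all letters at once. *)
  exists (\max_a m a); apply: (diamond_count_le I_sym I_irr diaS (s := Some alpha)).
  - exact: prefix_live.
  - exact: prefix_live.
  move=> a; apply: leq_trans (mP a) _; apply: trace_count_le.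
  by apply: prefix_le; exact: (leq_bigmax a).
apply/countable_injP; exists (fun xi => choice.pickle (code xi)).
move=> xi eta /set_mem xiX /set_mem etaX /(pcan_inj choice.pickleK) ce.
apply: dominated_antisym; [by case: xiX => -[] | by case: etaX => -[] | |];
  exact: code_dom.
Qed.

End InfiniteExecutions.

(** * Two determinant criteria *)

Section Determinants.
Local Open Scope ring_scope.

(** For a permutation [s] other than the identity, let [i] be a moved index of least height. Then
    [s i] is moved too, hence not lower than [i], so the factor [M i (s i)] is 0. *)
Lemma det_unitriangular (K : comNzRingType) n (M : 'M[K]_n) (ht : 'I_n -> nat) :
  (forall i, M i i = 1) ->
  (forall i j, i != j -> M i j != 0 -> (ht j < ht i)%N) -> \det M = 1.
Proof.
move=> Mii Mij; rewrite /determinant (bigD1 (1%g : 'S_n)) //= odd_perm1 mul1r.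
rewrite [X in X + _]big1 => [|i _]; last by rewrite perm1.
rewrite big1 ?addr0 // => s s1.
have [i0 si0] : exists i, s i != i.
  apply/existsP; apply: contraT => /existsPn fs; case/eqP: s1.
  by apply/permP => i; rewrite perm1; apply/eqP; have := fs i; rewrite negbK.
have [i si imin] := @arg_minnP _ i0 (fun i => s i != i) ht si0.
suff Mi0 : M i (s i) = 0 by rewrite (bigD1 i) //= Mi0 mul0r mulr0.
apply/eqP; apply: contraT => /(Mij i (s i)).
rewrite eq_sym si ltnNge => /(_ isT)/negP[]; apply: imin.
by rewrite (inj_eq perm_inj).
Qed.

Lemma det0_col (K : fieldType) n (M : 'M[K]_n) :
  \det M = 0 <-> exists2 v : 'I_n -> K,
    (exists i, v i != 0) & forall i, \sum_j M i j * v j = 0.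
Proof.
rewrite -det_tr; split=> [/eqP/det0P[v v0 vM]|[v [i vi] Mv]].
  exists (v 0) => [|i].
    apply/existsP; apply: contraNT v0 => /existsPn v0; apply/eqP/rowP => i.
    by apply/eqP; have := v0 i; rewrite negbK mxE.
  have /rowP/(_ i) := vM; rewrite !mxE => vMi; rewrite -[RHS]vMi.
  apply: eq_bigr => j _.
  by rewrite mxE mulrC.
apply/eqP/det0P; exists (\row_j v j).
  by apply: contraNneq vi => /rowP/(_ i); rewrite !mxE => ->.
apply/rowP => k; rewrite !mxE -[RHS](Mv k); apply: eq_bigr => j _.
by rewrite !mxE mulrC.
Qed.

End Determinants.

(** * The Mobius determinant and the characteristic root *)

Section CharacteristicRoot.
Local Open Scope ring_scope.
Variables (Sigma : finType) (I : rel Sigma) (X : finType).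
Hypotheses (I_sym : symmetric I) (I_irr : irreflexive I).
Variable S : concurrent_system I X.
Hypothesis diaS : diamond S.
Implicit Types (s : option X) (A c : {set Sigma}).

Definition mobius_at (K : comNzRingType) (z : K) : 'M[K]_#|X| :=
  \matrix_(i, j) \sum_(c : {set Sigma} | is_clique I c &&
      (act S (Some (enum_val i)) (clique_trace I c) == Some (enum_val j)))
    (- z) ^+ #|c|.

Lemma theta_horner (K : comNzRingType) (z : K) :
  (map_poly intr (theta S)).[z] = \det (mobius_at z).
Proof.
rewrite -[LHS]/((horner_eval z \o map_poly intr) (theta S)) -det_map_mx.
congr (\det _); apply/matrixP => i j; rewrite !mxE rmorph_sum /=.
apply: eq_bigr => c _; rewrite /horner_eval map_polyZ map_polyXn hornerZ hornerXn.
by rewrite rmorphXn rmorphN1 -exprNn.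
Qed.

(** The quantity [W s A]. It ranges over all subsets of [A], which the diamond makes live cliques
    once [A] is enabled at a state [s]. *)
Definition clique_sum (K : comNzRingType) (z : K) (v : option X -> K) s A : K :=
  \sum_(c : {set Sigma} | c \subset A)
    (- z) ^+ #|c| * v (act S s (clique_trace I c)).

(** Cliques not contained in the enabled set lead to the sink, where [v] vanishes. *)
Lemma mobius_at_sum (K : comNzRingType) (z : K) (v : option X -> K) i :
  v None = 0 -> let s := Some (enum_val i) in
  \sum_j mobius_at z i j * v (Some (enum_val j)) =
    clique_sum z v s (live_letters S s).
Proof.
move=> v0 s; under eq_bigr do rewrite mxE mulr_suml.
rewrite (exchange_big_dep (is_clique I)) /=; last by move=> j c _ /andP[].
transitivity (\sum_(c | is_clique I c)
    (- z) ^+ #|c| * v (act S s (clique_trace I c))).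
  apply: eq_bigr => c cI; rewrite cI /= -/s.
  case: (act S s _) => [beta|]; last by rewrite v0 mulr0 big_pred0.
  rewrite (big_pred1 (enum_rank beta)) ?enum_rankK // => j.
  by rewrite /= -(inj_eq enum_val_inj) enum_rankK eq_sym.
rewrite (bigID (fun c => c \subset live_letters S s)) /= [X in _ + X]big1.
  rewrite addr0; apply: eq_bigl => c; rewrite andbC.
  by case: (boolP (c \subset _)) => // /(diamond_clique I_sym diaS)[].
move=> c /andP[cI cs]; rewrite (_ : act S s _ = None) ?v0 ?mulr0 //.
by apply/eqP; apply: contraNT cs => /(clique_live_sub I_sym cI).
Qed.

Lemma clique_sumU1 (K : comNzRingType) (z : K) (v : option X -> K) s b A :
  b \notin A -> is_clique I (b |: A) ->
  clique_sum z v s (b |: A) =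
    clique_sum z v s A - z * clique_sum z v (act S s (letter I b)) A.
Proof.
move=> bA bAI; rewrite /clique_sum (@big_toggle _ _ _ _ b) => [|c _]; last first.
  by rewrite finset.subUset finset.sub1set setU11.
rewrite (eq_bigl (fun c : {set Sigma} => c \subset A)) => [|c]; last first.
  by rewrite -subsetD1 setU1K.
rewrite big_split /= mulr_sumr -sumrN; congr (_ + _); apply: eq_bigr => c cA.
have bc : b \notin c by apply: contra bA; apply/fintype.subsetP.
rewrite cardsU1 bc clique_traceU1 //; last first.
  by apply: is_cliqueS bAI; apply: finset.setUS.
by rewrite actM exprS -mulrA mulNr.
Qed.

Lemma clique_sum_eq0 (K : numFieldType) (z : K) (v : option X -> K) :
  `|z| < 1 -> v None = 0 ->
  (forall s, clique_sum z v s (live_letters S s) = 0) -> forall s, v s = 0.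
Proof.
move=> z1 v0 Wv.
(* Downward induction on the size of [A], run upward on [n]; the case [n = 0] is void. *)
suff W0 n s A : A \subset live_letters S s -> (#|Sigma| < #|A| + n)%N ->
    clique_sum z v s A = 0.
  move=> s; have := W0 #|Sigma|.+1 s finset.set0 (finset.sub0set _).
  rewrite cards0 => /(_ (ltnSn _)); rewrite /clique_sum (big_pred1 finset.set0).
    by rewrite cards0 expr0 mul1r clique_trace0 act1.
  by move=> c; rewrite /= finset.subset0.
elim: n s A => [|n IH] s A As An.
  by move: An; rewrite addn0 ltnNge max_card.
pose W (p : option X * {set Sigma}) := `|clique_sum z v p.1 p.2|.
pose P (p : option X * {set Sigma}) :=
  (p.2 \subset live_letters S p.1) && (#|Sigma| < #|p.2| + n.+1)%N.
have PsA : P (s, A) by rewrite /P As.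
(* The pairs of a state and a set form a finite type, so a largest modulus is attained. *)
have [[t B] /andP[/= Bt Bn] Wmax] :=
  @real_arg_maxP _ _ (s, A) P W PsA (fun p _ => normr_real _).
suff Wt : W (t, B) <= 0.
  by have := le_trans (Wmax _ PsA) Wt; rewrite normr_le0 => /eqP.
have [BE|] := eqVneq B (live_letters S t).
  by rewrite /W /= BE Wv normr0.
rewrite finset.eqEsubset Bt => /fintype.subsetPn[b bt bB].
have t0 : t != None by move: bt; rewrite inE => /live_state.
have bBt : b |: B \subset live_letters S t.
  by rewrite finset.subUset finset.sub1set bt.
have [bBI _] := diamond_clique I_sym diaS t0 bBt.
(* By the diamond, [B] stays enabled after [b], so this pair competes for the maximum too. *)
have PbB : P (act S t (letter I b), B).
  rewrite /P Bn andbT /=; apply/fintype.subsetP => a aB; rewrite inE.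
  have := fintype.subsetP Bt a aB; move: bt; rewrite !inE => lb la.
  have ba : b != a by apply: contraNneq bB => ->.
  by have [] := diaS ba lb la.
have WE : W (t, B) = `|z| * W (act S t (letter I b), B).
  rewrite /W -normrM /=; congr `| _ |; apply/eqP; rewrite -subr_eq0.
  rewrite -clique_sumU1 //; apply/eqP/IH => //.
  by rewrite cardsU1 bB add1n addSnnS.
have : W (t, B) <= `|z| * W (t, B) by rewrite {1}WE ler_wpM2l // Wmax.
by rewrite -subr_le0 -{1}[W _]mul1r -mulrBl pmulr_rle0 // subr_gt0.
Qed.

Definition halts s : Prop :=
  exists2 x, live S s x & live_letters S (act S s x) = finset.set0.

(** A terminating execution from [s] lies above every execution [y], so [y] can be completed to
    it. *)
Lemma halts_act s y : live S s y -> halts (act S s y) <-> halts s.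
Proof.
move=> ly; split=> [] [x lx xt].
  by exists (y * x)%g; rewrite ?liveM ?actM.
have /trace_leP[t xE] := terminal_max I_sym I_irr diaS lx xt ly.
by exists t; [rewrite -liveM -xE | rewrite -actM -xE].
Qed.

Lemma mobius_at_1_det0 (K : fieldType) alpha : ~ halts (Some alpha) ->
  \det (mobius_at (1 : K)) = 0.
Proof.
move=> nh; pose v s : K := ((s != None) && `[< ~ halts s >])%:R.
apply/det0_col; exists (fun j => v (Some (enum_val j))).
  exists (enum_rank alpha); rewrite enum_rankK /v /=.
  by rewrite (asboolT nh) oner_eq0.
move=> i; rewrite (@mobius_at_sum _ _ v) //; set s := Some _.
rewrite /clique_sum (eq_bigr (fun c => (-1) ^+ #|c| * v s)); last first.
  move=> c /(diamond_clique I_sym diaS (s := s) isT)[cI lc].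
  (* [v] is constant along executions, so it factors out and leaves an alternating sum, nonzero only
     at a terminal state, where [v] is 0. *)
  congr (_ * _); rewrite /v (live_act lc) /=; congr _%:R; congr nat_of_bool.
  by apply: asbool_equiv_eq; have := halts_act lc; tauto.
rewrite -mulr_suml; have := alternating_sum K (finset.sub0set (live_letters S s)).
under eq_bigl do rewrite finset.sub0set.
rewrite cards0 mulr1 => ->; case: eqP => [term|_]; last by rewrite mul0r.
rewrite /v asboolF ?andbF ?mulr0 // => nhs; apply: nhs.
by exists 1%g; rewrite ?live1 ?act1.
Qed.

Lemma halting_theta : (forall alpha, halts (Some alpha)) -> theta S = 1.
Proof.
(* The height is the length of the maximal execution, unique by [terminal_max]. A nonempty clique
   strictly lowers it, so only the empty one contributes to the diagonal. *)
move=> hS; have [ht htE] : exists ht : X -> nat, forall alpha x beta,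
    act S (Some alpha) x = Some beta ->
    (ht alpha = trace_length x + ht beta)%N.
  have /choice[w wP] : forall alpha, exists x, live S (Some alpha) x /\
      live_letters S (act S (Some alpha) x) = finset.set0.
    by move=> alpha; have [x] := hS alpha; exists x.
  exists (fun alpha => trace_length (w alpha)) => alpha x beta ax.
  have [la ta] := wP alpha; have [lb tb] := wP beta.
  rewrite -trace_lengthM; congr trace_length; apply/eqP; rewrite eq_le.
  have lxb : live S (Some alpha) (x * w beta)%g by rewrite liveM ax.
  by rewrite !(@terminal_max _ _ _ I_sym I_irr _ diaS (Some alpha)) // actM ax.
apply: (det_unitriangular (ht := fun i => ht (enum_val i))) => [i|i j ij].
  rewrite mxE (big_pred1 finset.set0) ?cards0 ?scale1r // => c.
  apply/andP/eqP => [[cI /eqP/htE]|->].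
    move/eqP; rewrite trace_length_clique -{1}[ht _]add0n eqn_add2r eq_sym.
    by rewrite cards_eq0 => /eqP.
  by rewrite clique_trace0 act1; split=> //; apply/is_cliqueP => a b; rewrite inE.
rewrite mxE; apply: contraNT; rewrite -leqNgt => hij.
apply/eqP; apply: big_pred0 => c; apply/negP => /andP[cI /eqP act_c].
have := htE _ _ _ act_c; rewrite trace_length_clique => hE.
have c0 : #|c| == 0%N.
  by move: hij; rewrite hE -[X in (_ <= X)%N]add0n leq_add2r leqn0.
move: act_c; rewrite (eqP (etrans (esym (cards_eq0 c)) c0)) clique_trace0 act1.
by case=> /enum_val_inj ijE; rewrite ijE eqxx in ij.
Qed.

End CharacteristicRoot.

Theorem theorem1 (R : realType) (Sigma : finType) (I : rel Sigma) (X : finType)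
    (I_sym : symmetric I) (I_irr : irreflexive I)
    (S : concurrent_system I X) (S_nontrivial : nontrivial S) :
  ((forall alpha : X, enabled S alpha <> finset.set0) ->
     (deterministic S <-> probabilistic (dominant S R)))
  /\
  (deterministic S ->
     (forall alpha : X, countable (infinite_executions S alpha)) /\
     exists r : \bar R,
       is_characteristic_root S r /\ (r = 1%:E \/ r = +oo)%E).
Proof.
split=> [en0|/(deterministic_diamond I_sym I_irr) diaS].
  split=> [/(deterministic_diamond I_sym I_irr)|].
    exact: diamond_probabilistic.
  by move/(probabilistic_diamond I_sym)/(diamond_deterministic I_sym I_irr).
split; first exact: countable_infinite_executions.
have [hS|/existsNP[alpha nh]] := pselect (forall alpha, halts S (Some alpha)).
  exists +oo%E; split; last by right.
  by rewrite /= halting_theta ?size_poly1.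
exists 1%:E; split; last by left.
split=> [||| z]; [exact: ltr01 | exact: lexx | |].
  by rewrite /root rmorph1 theta_horner (mobius_at_1_det0 I_sym I_irr diaS _ nh).
rewrite /root theta_horner rmorph1 => /eqP/det0_col[v [i vi] Mv].
rewrite real_leNgt ?real1 ?normr_real //; apply/negP => z1.
(* The kernel vector of a root of modulus below 1 is extended by 0 at the sink. *)
pose v' s := if s is Some alpha then v (enum_rank alpha) else 0%R.
case/eqP: vi; rewrite -(enum_valK i) -[LHS]/(v' (Some (enum_val i))).
apply: (clique_sum_eq0 I_sym diaS z1) => // -[alpha'|].
  rewrite -(enum_rankK alpha') -(mobius_at_sum I_sym diaS) //.
  rewrite -[RHS](Mv (enum_rank alpha')).
  by apply: eq_bigr => j _; rewrite /= enum_valK.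
rewrite /clique_sum big1 // => c _.
by rewrite act_sink mulr0.
Qed.
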